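(* Let $V$ be a diffeological vector space in $\mathcal{DV}$, i.e. whose diffeology is determined by its smooth linear functionals. Then the following conditions on $V$ are equivalent: the smooth linear functionals on $V$ separate points; the smooth functionals on $V$ separate points; every finite-dimensional subspace of $V$ is fine; the $D$-topology on $V$ is Hausdorff. In other words, when restricted to $V$ in $\mathcal{DV}$, the collections $\mathcal{SV}$, $\mathcal{SD}$, $\mathcal{FFV}$ and $\mathcal{HT}$ of diffeological vector spaces satisfying these respective conditions agree.
   Context: A diffeological space is a set $X$ together with a specified set of functions $U\to X$ (called plots) for each open set $U\subseteq\mathbb{R}^n$ and each $n\in\mathbb{N}$, such that: (1) every constant function $U\to X$ is a plot; (2) if $U\to X$ is a plot and $V\to U$ is smooth ($V$ open in some $\mathbb{R}^m$), then the composite $V\to U\to X$ is a plot; (3) if $U=\bigcup_i U_i$ is an open cover and $U\to X$ is a function each of whose restrictions $U_i\to X$ is a plot, then $U\to X$ is a plot. A function $f:X\to Y$ between diffeological spaces is smooth if $f\circ p$ is a plot of $Y$ for every plot $p$ of $X$. $\mathbb{R}^n$ carries the standard diffeology (plots are the usual smooth maps). Subsets carry the sub-diffeology (plots are the functions that are plots of the ambient space) and products carry the product diffeology (plots are the functions all of whose components are plots). A subset $A\subseteq X$ is $D$-open if $p^{-1}(A)$ is open for every plot $p$ of $X$; the $D$-open sets form the $D$-topology. A diffeological vector space is a real vector space $V$ with a diffeology such that addition $V\times V\to V$ and scalar multiplication $\mathbb{R}\times V\to V$ are smooth. A subspace means a linear subspace with the sub-diffeology. $V$ is fine if its diffeology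 is the smallest (fewest plots) diffeology making the vector space $V$ a diffeological vector space. The smooth functionals (resp. smooth linear functionals) on $V$ separate points if for all $x\neq y$ in $V$ there is a smooth (resp. smooth linear) map $f:V\to\mathbb{R}$ with $f(x)\neq f(y)$. $\mathcal{DV}$ is the collection of diffeological vector spaces $V$ whose diffeology is determined by the smooth linear functionals: a function $p:U\to V$ ($U$ open in some $\mathbb{R}^n$) is a plot if and only if $\ell\circ p:U\to\mathbb{R}$ is smooth for every smooth linear functional $\ell:V\to\mathbb{R}$. *)

(* Defs.v *)
From HB Require Import structures.
From mathcomp Require Import all_boot all_order all_algebra.
From mathcomp Require Import all_classical all_reals all_analysis.

Set Implicit Arguments.
Unset Strict Implicit.
Unset Printing Implicit Defensive.

Import Order.TTheory GRing.Theory Num.Theory.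
Import numFieldNormedType.Exports.

Local Open Scope classical_set_scope.
Local Open Scope ring_scope.

(* A function on an open set U of R^n is encoded as a total function on R^n of
   which only the values on U matter. For open U, the notions below depend only
   on these values, since continuity and directional derivatives are local. *)

Fixpoint Ck_on {R : realType} {n : nat} {W : normedModType R} (k : nat)
    (U : set 'rV[R]_n) (f : 'rV[R]_n -> W) : Prop :=
  (forall x, U x -> {for x, continuous f}) /\
  match k with
  | 0 => True
  | k'.+1 => forall i : 'I_n,
      (forall x, U x -> derivable f x (delta_mx 0 i)) /\
      Ck_on k' U ('D_(delta_mx 0 i) f)
  end.

Definition smooth_on {R : realType} {n : nat} {W : normedModType R}
    (U : set 'rV[R]_n) (f : 'rV[R]_n -> W) : Prop :=
  forall k, Ck_on k U f.

(* D n U p is meant to say that U is open in R^n and that the restriction of p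
   to U is a plot. *)
Definition plots (R : realType) (X : Type) : Type :=
  forall n : nat, set 'rV[R]_n -> ('rV[R]_n -> X) -> Prop.

Record is_diffeology {R : realType} {X : Type} (D : plots R X) : Prop := {
  plot_open : forall n (U : set 'rV[R]_n) p, D n U p -> open U ;
  (* being a plot depends only on the restriction to U *)
  plot_ext : forall n (U : set 'rV[R]_n) p q,
    (forall x, U x -> p x = q x) -> D n U p -> D n U q ;
  plot_cst : forall n (U : set 'rV[R]_n) (x : X), open U -> D n U (fun=> x) ;
  plot_comp : forall m n (U : set 'rV[R]_n) (V : set 'rV[R]_m) p
      (h : 'rV[R]_m -> 'rV[R]_n),
    D n U p -> open V -> smooth_on V h -> h @` V `<=` U -> D m V (p \o h) ;
  plot_cover : forall n (I : Type) (U : I -> set 'rV[R]_n) p,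
    (forall i, D n (U i) p) -> D n (\bigcup_i U i) p
}.

Definition smooth_map {R : realType} {X Y : Type}
    (DX : plots R X) (DY : plots R Y) (f : X -> Y) : Prop :=
  forall n (U : set 'rV[R]_n) p, DX n U p -> DY n U (f \o p).

Definition std_plots {R : realType} (W : normedModType R) : plots R W :=
  fun n U p => open U /\ smooth_on U p.
Arguments std_plots {R} W n U p.

Definition prod_plots {R : realType} {X Y : Type}
    (DX : plots R X) (DY : plots R Y) : plots R (X * Y)%type :=
  fun n U p => DX n U (fst \o p) /\ DY n U (snd \o p).

(* The sub-diffeology, for S given with its inclusion i into X. *)
Definition sub_plots {R : realType} {X S : Type}
    (DX : plots R X) (i : S -> X) : plots R S :=
  fun n U p => DX n U (i \o p).

Definition D_open {R : realType} {X : Type} (D : plots R X) (A : set X) : Prop :=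
  forall n (U : set 'rV[R]_n) p, open U -> D n U p -> open (U `&` p @^-1` A).

(* A copy of X carrying the D-topology of D. *)
Definition D_space {R : realType} {X : choiceType} (D : plots R X) : Type := X.

Section DTopology.
Variables (R : realType) (X : choiceType) (D : plots R X).

HB.instance Definition _ := Choice.on (D_space D).

Lemma D_openT : D_open D [set: X].
Proof. by move=> n U p oU _; rewrite preimage_setT setIT. Qed.

Lemma D_openI : setI_closed (D_open D).
Proof.
move=> A B oA oB n U p oU Dp; rewrite preimage_setI setIIr.
by apply: openI; [exact: oA|exact: oB].
Qed.

Lemma D_open_bigcup (I : Type) (A : I -> set X) :
  (forall i, D_open D (A i)) -> D_open D (\bigcup_i A i).
Proof.
move=> oA n U p oU Dp; rewrite preimage_bigcup setI_bigcupr.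
by apply: bigcup_open => i _; exact: oA.
Qed.

HB.instance Definition _ := isOpenTopological.Build (D_space D)
  D_openT D_openI D_open_bigcup.

End DTopology.

Record is_dvs {R : realType} {V : lmodType R} (D : plots R V) : Prop := {
  dvs_diffeology : is_diffeology D ;
  dvs_add : smooth_map (prod_plots D D) D (fun u : V * V => u.1 + u.2) ;
  dvs_scale : smooth_map (prod_plots (std_plots R) D) D
                (fun u : R * V => u.1 *: u.2)
}.

Definition fine {R : realType} {V : lmodType R} (D : plots R V) : Prop :=
  is_dvs D /\
  forall D' : plots R V, is_dvs D' -> forall n U p, D n U p -> D' n U p.

Definition finite_dimensional {R : realType} (V : lmodType R) : Prop :=
  exists (d : nat) (e : 'I_d -> V), forall v : V,
    exists c : 'I_d -> R, v = \sum_(i < d) c i *: e i.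

Definition smooth_functional {R : realType} {V : lmodType R} (D : plots R V)
    (f : V -> R) : Prop :=
  smooth_map D (std_plots R) f.

Definition in_SV {R : realType} {V : lmodType R} (D : plots R V) : Prop :=
  forall x y : V, x <> y ->
    exists l : {scalar V}, smooth_functional D l /\ l x <> l y.

Definition in_SD {R : realType} {V : lmodType R} (D : plots R V) : Prop :=
  forall x y : V, x <> y ->
    exists f : V -> R, smooth_functional D f /\ f x <> f y.

(* W ranges over the linear subspaces of V: it is the subspace {x | S x},
   with inclusion val. *)
Definition in_FFV {R : realType} {V : lmodType R} (D : plots R V) : Prop :=
  forall (S : pred V) (W : subLmodType S),
    finite_dimensional W -> fine (sub_plots D (val : W -> V)).

Definition in_HT {R : realType} {V : lmodType R} (D : plots R V) : Prop :=
  hausdorff_space (D_space D).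

Definition in_DV {R : realType} {V : lmodType R} (D : plots R V) : Prop :=
  is_dvs D /\
  forall n (U : set 'rV[R]_n) (p : 'rV[R]_n -> V), open U ->
    (D n U p <-> forall l : {scalar V}, smooth_functional D l ->
                   smooth_on U (l \o p)).

(* Main.v *)
Require Import Defs.
From HB Require Import structures.
From mathcomp Require Import all_boot all_order all_algebra.
From mathcomp Require Import all_classical all_reals all_analysis.

(** The implications form two loops through the separation of points by smooth
linear functionals: to separation by smooth functionals, to the Hausdorff
property and back, and to fineness of the finite-dimensional subspaces and
back. The steps leaving this condition hold in every diffeological vector
space; only the returns use that the diffeology of V is determined by its
smooth linear functionals.

Leaving. A smooth functional is continuous for the D-topology, so a space
whose smooth functionals separate points is Hausdorff ([in_SD_HT]). For
fineness, let E be finite-dimensional with smooth linear functionals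
separating points, and let D' be a vector space diffeology on E contained in
the given one D. The claim is that the identity is smooth from D to D'. By
induction on a finite list of vectors there is a linear map smooth from D to
D' that fixes them all ([smooth_linear_fixing]): a map pi that leaves a
residual r = e - pi e at one more vector e is corrected by a multiple of r,
the coefficient being a smooth linear functional applied to x - pi x. For a
spanning list this map is the identity. An arbitrary competitor D' is
replaced with its intersection with D.

Returning. Suppose that no smooth linear functional tells x from y. When the
diffeology is determined by these functionals, every function into the affine
line through x and y, however wild, is a plot ([unseparated_plot]). The plot
that jumps from x to y at a single parameter shows that every D-open set
around x contains y, so V is not Hausdorff. Moreover the line spanned by
x - y carries all functions as plots; it is not fine, because the continuous
functions already form a smaller vector space diffeology on a line
([continuous_plots_dvs]). *)

Set Implicit Arguments.
Unset Strict Implicit.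
Unset Printing Implicit Defensive.

Import Order.TTheory GRing.Theory Num.Theory.
Import numFieldNormedType.Exports.

Local Open Scope classical_set_scope.
Local Open Scope ring_scope.

(** * Two facts about functions of real variables *)

Lemma smooth_on_cst (R : realType) (n : nat) (W : normedModType R)
  (U : set 'rV[R]_n) (w : W) : smooth_on U (fun=> w).
Proof.
move=> k; elim: k w => [|k IHk] w /=; split=> //.
- by move=> x _; exact: cst_continuous.
- by move=> x _; exact: cst_continuous.
move=> i; split=> [x _|]; first exact: derivable_cst.
rewrite (_ : 'D_(delta_mx 0 i) (fun=> w) = fun=> 0); first exact: IHk.
by apply/funext => x; exact: derive_cst.
Qed.

Lemma nbhs0_rV1 (R : realType) (A : set 'rV[R]_1) :
  nbhs (0 : 'rV[R]_1) A -> exists2 t, A t & t != 0.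
Proof.
move=> /nbhs_ballP[e /= e0 eA]; exists (const_mx (e / 2)).
  apply: eA; split=> // i j; rewrite !mxE -ball_normE /= sub0r normrN.
  by rewrite gtr0_norm ?divr_gt0// ltr_pdivrMr// ltr_pMr// ltr1n.
by apply/eqP => /rowP/(_ 0); rewrite !mxE; apply/eqP; rewrite gt_eqF// divr_gt0.
Qed.

(** * Plots in diffeological vector spaces *)

Section DiffeologicalVectorSpaces.
Context {R : realType} {V : lmodType R} (D : plots R V).
Arguments D : clear implicits.
Hypothesis dvsD : is_dvs D.

Lemma dvs_plot_open n (U : set 'rV[R]_n) p : D n U p -> open U.
Proof. exact: (plot_open (dvs_diffeology dvsD)). Qed.

Lemma dvs_plotD n (U : set 'rV[R]_n) p q :
  D n U p -> D n U q -> D n U (fun x => p x + q x).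
Proof. by move=> Dp Dq; apply: (dvs_add dvsD (p := fun x => (p x, q x))). Qed.

Lemma dvs_plotZ n (U : set 'rV[R]_n) (a : 'rV[R]_n -> R) p :
  smooth_on U a -> D n U p -> D n U (fun x => a x *: p x).
Proof.
move=> sa Dp; apply: (dvs_scale dvsD (p := fun x => (a x, p x))).
by split=> //; split=> //; exact: dvs_plot_open Dp.
Qed.

Lemma dvs_plotB n (U : set 'rV[R]_n) p q :
  D n U p -> D n U q -> D n U (fun x => p x - q x).
Proof.
move=> Dp Dq; apply: dvs_plotD => //.
have -> : (fun x => - q x) = (fun x => (-1) *: q x).
  by apply/funext => x; rewrite scaleN1r.
by apply: dvs_plotZ => //; exact: smooth_on_cst.
Qed.

End DiffeologicalVectorSpaces.

Lemma sub_plots_dvs (R : realType) (V W : lmodType R) (D : plots R V)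
  (i : {linear W -> V}) : is_dvs D -> is_dvs (sub_plots D i).
Proof.
move=> dvsD; have diffD := dvs_diffeology dvsD; split; first split.
- by move=> n U p; exact: (plot_open diffD).
- by move=> n U p q pq; apply: (plot_ext diffD) => x Ux /=; rewrite pq.
- by move=> n U x oU; exact: (plot_cst diffD).
- by move=> m n U A p h Dp oA sh hU; exact: (plot_comp diffD Dp).
- by move=> n I U p Dp; exact: (plot_cover diffD).
- move=> n U p [D1 D2]; rewrite /sub_plots.
  have -> : i \o ((fun u => u.1 + u.2) \o p) =
      (fun x => i (p x).1 + i (p x).2) by apply/funext => x /=; rewrite linearD.
  exact: dvs_plotD.
- move=> n U p [[_ s1] D2]; rewrite /sub_plots.
  have -> : i \o ((fun u => u.1 *: u.2) \o p) =
      (fun x => (p x).1 *: i (p x).2).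
    by apply/funext => x /=; rewrite linearZ.
  exact: dvs_plotZ.
Qed.

(** This makes it possible to compare two vector space diffeologies on the same
space under the assumption that one contains the other. *)
Lemma setI_plots_dvs (R : realType) (V : lmodType R) (D D' : plots R V) :
  is_dvs D -> is_dvs D' -> is_dvs (fun n U p => D n U p /\ D' n U p).
Proof.
move=> dvsD dvsD'.
have [diffD diffD'] := (dvs_diffeology dvsD, dvs_diffeology dvsD').
split; first split.
- by move=> n U p [/(plot_open diffD)].
- by move=> n U p q pq [/(plot_ext diffD pq) ? /(plot_ext diffD' pq)].
- by move=> n U x oU; split; [exact: (plot_cst diffD)|exact: (plot_cst diffD')].
- move=> m n U A p h [Dp D'p] oA sh hU.
  by split; [exact: (plot_comp diffD Dp)|exact: (plot_comp diffD' D'p)].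
- move=> n I U p Dp.
  by split; [apply: (plot_cover diffD)|apply: (plot_cover diffD')] => i;
    have [] := Dp i.
- move=> n U p [[? ?] [? ?]].
  by split; [exact: (dvs_add dvsD)|exact: (dvs_add dvsD')].
- move=> n U p [sp [? ?]].
  by split; [exact: (dvs_scale dvsD)|exact: (dvs_scale dvsD')].
Qed.

(** * Separation by smooth linear functionals implies fineness *)

Section SeparatedFiniteDimensional.
Context {R : realType} {V : lmodType R} (D D' : plots R V).
Arguments D : clear implicits.
Arguments D' : clear implicits.
Hypotheses (dvsD : is_dvs D) (dvsD' : is_dvs D') (sepD : in_SV D).
Hypothesis D'D : forall n (U : set 'rV[R]_n) p, D' n U p -> D n U p.

(** The map is a projector built one vector at a time. The inclusion of D' in
D matters because the coefficient f (x - pi x) is smooth only if pi is smooth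
into D, on which f is a smooth functional. *)
Lemma smooth_linear_fixing (s : seq V) :
  exists pi : {linear V -> V},
    smooth_map D D' pi /\ forall e, e \in s -> pi e = e.
Proof.
elim: s => [|e s [pi [spi pis]]].
  exists (@GRing.null_fun _ _ : {linear V -> V}); split=> // n U p Dp.
  by apply: (plot_cst (dvs_diffeology dvsD')); exact: (dvs_plot_open dvsD Dp).
pose r := e - pi e.
have [r0|r0] := pselect (r = 0).
  exists pi; split=> // x; rewrite inE => /orP[/eqP->|/pis//].
  by apply/esym/subr0_eq.
have [f [sf]] := sepD r0; rewrite linear0 => fr0.
(* The correction vanishes where pi is already the identity, and at e its
   coefficient is f r, so normalizing by f r adds exactly r = e - pi e. *)
pose g x := pi x + f (x - pi x) *: ((f r)^-1 *: r).
have glin : linear g.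
  move=> a x y; rewrite /g (linearP pi).
  have -> : a *: x + y - (a *: pi x + pi y) =
            a *: (x - pi x) + (y - pi y) by rewrite scalerBr opprD addrACA.
  by rewrite (linearP f) /= scalerDl -scalerA addrACA -scalerDr.
pose G := HB.pack_for {linear V -> V} g (GRing.isLinear.Build _ _ _ _ g glin).
exists G; split=> [n U p Dp|x /=].
  have D'pi := spi _ _ _ Dp.
  apply: (dvs_plotD dvsD' D'pi); apply: (dvs_plotZ dvsD').
    by have [] := sf _ _ _ (dvs_plotB dvsD Dp (D'D D'pi)).
  by apply: (plot_cst (dvs_diffeology dvsD')); exact: (dvs_plot_open dvsD Dp).
rewrite inE /g => /orP[/eqP->|xs];
  last by rewrite pis// subrr linear0 scale0r addr0.
by rewrite scalerA divff ?scale1r; [rewrite addrC subrK|apply/eqP].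
Qed.

Lemma fin_dim_coarser_plot n (U : set 'rV[R]_n) p :
  finite_dimensional V -> D n U p -> D' n U p.
Proof.
move=> [d [e spane]] Dp.
have [pi [spi pie]] := smooth_linear_fixing [seq e i | i <- enum 'I_d].
suff piid v : pi v = v.
  rewrite (_ : p = pi \o p); first exact: spi.
  by apply/funext => x /=.
have [c ->] := spane v; rewrite linear_sum; apply: eq_bigr => i _.
by rewrite linearZ pie// map_f// mem_enum.
Qed.

End SeparatedFiniteDimensional.

(** Minimality is tested against the intersection of D with the competitor,
which is a vector space diffeology contained in D. *)
Lemma in_SV_fin_dim_fine (R : realType) (V : lmodType R) (D : plots R V) :
  is_dvs D -> in_SV D -> finite_dimensional V -> Defs.fine D.
Proof.
move=> dvsD sepD fdV; split=> // D' dvsD' n U p Dp.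
suff [] : D n U p /\ D' n U p by [].
have dvsI := setI_plots_dvs dvsD dvsD'.
by apply: (fin_dim_coarser_plot dvsD dvsI) => // m A q [].
Qed.

Lemma in_SV_sub (R : realType) (V W : lmodType R) (D : plots R V)
  (i : {linear W -> V}) : injective i -> in_SV D -> in_SV (sub_plots D i).
Proof.
move=> injI sepD x y xy.
have [l [sl lxy]] := sepD (i x) (i y) (contra_not (@injI _ _) xy).
exists (l \o i : {scalar W}); split=> // n U p Dp; exact: (sl _ _ _ Dp).
Qed.

Lemma in_SV_FFV (R : realType) (V : lmodType R) (D : plots R V) :
  is_dvs D -> in_SV D -> in_FFV D.
Proof.
move=> dvsD sepD S W; apply: in_SV_fin_dim_fine; first exact: sub_plots_dvs.
by apply: in_SV_sub => //; exact: val_inj.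
Qed.

(** * Separation by smooth functionals and the D-topology *)

Lemma in_SV_SD (R : realType) (V : lmodType R) (D : plots R V) :
  in_SV D -> in_SD D.
Proof. by move=> sepD x y /sepD[l [sl lxy]]; exists l. Qed.

Lemma smooth_functional_continuous (R : realType) (V : lmodType R)
  (D : plots R V) (f : V -> R) :
  smooth_functional D f -> continuous (f : D_space D -> R).
Proof.
move=> sf; apply/continuousP => A oA.
suff : D_open D (f @^-1` A) by [].
move=> n U p oU Dp.
have [_ /(_ 0%N)[cf _]] := sf _ _ _ Dp.
rewrite openE => x [Ux Afpx]; apply: filterI; first exact: open_nbhs_nbhs.
by apply: (cf x Ux); exact: open_nbhs_nbhs.
Qed.

Lemma in_SD_HT (R : realType) (V : lmodType R) (D : plots R V) :
  in_SD D -> in_HT D.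
Proof.
move=> sepD x y xy; apply: contrapT => /sepD[f [sf]].
have cf := smooth_functional_continuous sf.
apply; apply: (@norm_hausdorff R R^o) => A B fA fB.
have [z [Az Bz]] := xy _ _ (cf _ _ fA) (cf _ _ fB).
by exists (f z).
Qed.

(** * Points that no smooth linear functional separates *)

Section Unseparated.
Context {R : realType} {V : lmodType R} (D : plots R V).
Arguments D : clear implicits.
Hypothesis DV : in_DV D.

Definition unseparated (x y : V) :=
  forall l : {scalar V}, smooth_functional D l -> l x = l y.

(** Every smooth linear functional is constant along such a function, whatever
its regularity. *)
Lemma unseparated_plot n (U : set 'rV[R]_n) p x :
  open U -> (forall t, unseparated (p t) x) -> D n U p.
Proof.
move=> oU px; apply/(DV.2 _ _ _ oU) => l sl.
rewrite (_ : l \o p = fun=> l x); first exact: smooth_on_cst.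
by apply/funext => t /=; exact: px.
Qed.

(** The function equal to x at the origin and to y elsewhere is a plot, and the
origin is not isolated in the domain. *)
Lemma unseparated_D_open (A : set V) x y :
  unseparated x y -> D_open D A -> A x -> A y.
Proof.
move=> xy oA Ax; pose p (t : 'rV[R]_1) := if t == 0 then x else y.
have Dp : D 1%N setT p.
  apply: (@unseparated_plot _ _ _ y openT) => t l sl.
  by rewrite /p; case: ifP => // _; exact: xy.
have : nbhs (0 : 'rV[R]_1) (setT `&` p @^-1` A).
  apply: open_nbhs_nbhs; split; first exact: oA openT Dp.
  by split=> //=; rewrite /p eqxx.
by move=> /nbhs0_rV1[t [_ /=]]; rewrite /p => + /negPf t0; rewrite t0.
Qed.

Lemma in_HT_SV : in_HT D -> in_SV D.
Proof.
move=> HT x y xy; apply: contrapT => nsep; apply/xy/HT => A B.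
have uxy : unseparated x y.
  by move=> l sl; apply: contrapT => lxy; apply: nsep; exists l.
rewrite nbhsE => -[A' [oA' A'x] A'A] By.
exists y; split; last exact: (@nbhs_singleton (D_space D)).
exact/A'A/(unseparated_D_open uxy oA' A'x).
Qed.

End Unseparated.

(** * Lines carrying all functions as plots are not fine *)

(** Continuity is used in place of smoothness because it is stable under
composition with smooth maps without any chain rule, and any diffeology that
excludes a jump suffices to refute fineness. *)
Definition continuous_plots (R : realType) (W : lmodType R) (f : W -> R) :
    plots R W :=
  fun n U p => open U /\ forall t, U t -> {for t, continuous (f \o p)}.

Lemma continuous_plots_dvs (R : realType) (W : lmodType R) (f : {scalar W}) :
  is_dvs (continuous_plots f).
Proof.
split; first split.
- by move=> n U p [].
- move=> n U p q pq [oU cp]; split=> // t Ut.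
  have /near_eq_cvg fpq : \forall s \near t, (f \o p) s = (f \o q) s.
    by apply: filterS (open_nbhs_nbhs (conj oU Ut)) => s Us /=; rewrite pq.
  by move: (cp t Ut); rewrite /prop_for /continuous_at /= pq// => /(cvg_trans fpq).
- by move=> n U w oU; split=> // t _; exact: cst_continuous.
- move=> m n U A p h [oU cp] oA sh hU; split=> // t At.
  have [ch _] := sh 0%N.
  by apply: (@continuous_comp _ _ _ h (f \o p)); [exact: ch|apply/cp/hU; exists t].
- move=> n I U p cp; split; first by apply: bigcup_open => i _; have [] := cp i.
  by move=> t [i _ Uit]; have [_] := cp i; exact.
- move=> n U p [[oU c1] [_ c2]]; split=> // t Ut.
  rewrite (_ : f \o _ = (f \o (fst \o p)) \+ (f \o (snd \o p))).
    by apply: continuousD; [exact: c1|exact: c2].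
  by apply/funext => s /=; rewrite linearD.
- move=> n U p [[oU /(_ 0%N)[c1 _]] [_ c2]]; split=> // t Ut.
  rewrite (_ : f \o _ = (fst \o p) \* (f \o (snd \o p))).
    by apply: continuousM; [exact: c1|exact: c2].
  by apply/funext => s /=; rewrite linearZ.
Qed.

(** The line spanned by v is modelled on the field of scalars itself, embedded
by c |-> c *: v, so that its coordinate is the identity. The proof that v is
nonzero is an argument of the type because injectivity of the embedding, hence
the subspace structure attached to the type, depends on it. *)
Definition line (R : realType) (V : lmodType R) (v : V) (v0 : v != 0) : Type :=
  R^o.

Section Line.
Context {R : realType} {V : lmodType R} (v : V) (v0 : v != 0).

HB.instance Definition _ := GRing.Lmodule.on (line v0).

Definition on_line : pred V := fun u => `[< exists c : R, u = c *: v >].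

Definition line_val (c : line v0) : V := (c : R) *: v.

Definition line_Sub (u : V) (uv : on_line u) : line v0 :=
  projT1 (cid (asboolW uv)).

Lemma line_SubK u uv : line_val (@line_Sub u uv) = u.
Proof. by rewrite /line_val /line_Sub; case: cid. Qed.

Lemma line_val_inj : injective line_val.
Proof.
move=> a b /eqP; rewrite -subr_eq0 -scalerBl scaler_eq0 (negPf v0) orbF.
rewrite subr_eq0.
by move/eqP.
Qed.

Lemma on_line_val c : on_line (line_val c).
Proof. by apply/asboolP; exists c. Qed.

Lemma line_rect (K : line v0 -> Type) :
  (forall u uv, K (@line_Sub u uv)) -> forall c, K c.
Proof.
move=> KS c; suff <- : line_Sub (on_line_val c) = c by [].
by apply: line_val_inj; rewrite line_SubK.
Qed.

HB.instance Definition _ := isSub.Build V on_line (line v0) line_rect line_SubK.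

Lemma line_valB : zmod_morphism (val : line v0 -> V).
Proof. by move=> a b; rewrite /val/= /line_val scalerBl. Qed.

HB.instance Definition _ :=
  GRing.isSubZmodule.Build V on_line (line v0) line_valB.

Lemma line_valZ : scalable (val : line v0 -> V).
Proof. by move=> a b; rewrite /val/= /line_val scalerA. Qed.

HB.instance Definition _ :=
  GRing.isSubLmodule.Build R V on_line (line v0) line_valZ.

Lemma line_fin_dim : finite_dimensional (line v0).
Proof.
exists 1%N, (fun=> (1 : R) : line v0) => c; exists (fun=> (c : R)).
by rewrite big_ord1; apply/esym/mulr1.
Qed.

End Line.

(** Fineness of the line spanned by x - y would make the jump below continuous,
since every function into that line is a plot. *)
Lemma in_FFV_SV (R : realType) (V : lmodType R) (D : plots R V) :
  in_DV D -> in_FFV D -> in_SV D.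
Proof.
move=> DV ffD x y xy; apply: contrapT => nsep.
have v0 : x - y != 0 by rewrite subr_eq0; apply/eqP.
have [_ /(_ _ (continuous_plots_dvs (@idfun R^o : {scalar line v0})))] :=
  ffD _ (line v0 : subLmodType _) (line_fin_dim v0).
pose p (t : 'rV[R]_1) : line v0 := ((t == 0)%:R : R).
move=> /(_ 1%N setT p)[].
  apply: (@unseparated_plot _ _ _ DV _ _ _ 0 openT) => t l sl.
  rewrite /= linear0 [val _]/(_ *: _) linearZ linearB /=.
  rewrite (_ : l x = l y) ?subrr ?mulr0//.
  by apply: contrapT => lxy; apply: nsep; exists l.
move=> _ /(_ 0 I) cp.
have /cp/= /nbhs0_rV1[t] : nbhs ((@idfun R^o \o p) 0) [set r : R^o | 0 < r].
  by apply: open_nbhs_nbhs; split; [exact: open_gt|rewrite /= /p eqxx /=].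
by rewrite /p => + /negPf t0; rewrite /= t0 ltxx.
Qed.

Theorem theorem1p3 (R : realType) (V : lmodType R) (D : plots R V) :
  in_DV D ->
  (in_SV D <-> in_SD D) /\ (in_SV D <-> in_FFV D) /\ (in_SV D <-> in_HT D).
Proof.
move=> DV; have HT_SV := @in_HT_SV _ _ _ DV.
have [SV_SD SD_HT] := (@in_SV_SD R V D, @in_SD_HT R V D).
split; [|split]; split=> //.
- by move=> /SD_HT.
- exact: in_SV_FFV DV.1.
- exact: in_FFV_SV.
- by move=> /SV_SD.
Qed.
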